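(* Fix $p\in(1,\infty)$ and let $(X,\|\cdot\|_X)$ be a Banach space with $\mathfrak{s}_p(X)<\infty$. If, additionally, $X$ is a UMD$^-$ space, then for every $n\in\mathbb{N}$ and all functions $f_1,\ldots,f_n:\mathcal{C}_n\to X$, we have $$\Big\| \sum_{i=1}^n (\mathcal{E}_i f_i - \mathcal{E}_{i-1}f_i)\Big\|_{L_p(\mathcal{C}_n;X)} \leq \mathfrak{s}_p(X)\, \beta_p^-(X) \Big(\frac{1}{2^n} \sum_{\delta\in\mathcal{C}_n} \Big\| \sum_{i=1}^n \delta_i \partial_i f_i\Big\|_{L_p(\mathcal{C}_n;X)}^p\Big)^{1/p}.$$ Consequently (choosing $f_1=\cdots=f_n=f$), the constants in Pisier's inequality satisfy $$\sup_{n\in\mathbb{N}} \mathfrak{P}_p^n(X) \leq \mathfrak{s}_p(X)\, \beta_p^-(X).$$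
   Context: Notation. $\mathcal{C}_n=\{-1,1\}^n$ is the discrete hypercube, and points $\delta\in\mathcal{C}_n$ are written $\delta=(\delta_1,\ldots,\delta_n)$. For a measure space $(\Omega,\mathcal{F},\mu)$ and $f:\Omega\to X$, $\|f\|_{L_p(\Omega,\mu;X)}^p=\int_\Omega\|f(\omega)\|_X^p\,d\mu(\omega)$. For finite $\Omega$ with the normalized counting measure one writes $\|f\|_{L_p(\Omega;X)}$; thus $\|f\|_{L_p(\mathcal{C}_n;X)}^p=\frac1{2^n}\sum_{\varepsilon\in\mathcal{C}_n}\|f(\varepsilon)\|_X^p$. For $i\in\{1,\ldots,n\}$ the $i$-th partial derivative of $f:\mathcal{C}_n\to X$ is $$\partial_i f(\varepsilon)=\frac{f(\varepsilon)-f(\varepsilon_1,\ldots,\varepsilon_{i-1},-\varepsilon_i,\varepsilon_{i+1},\ldots,\varepsilon_n)}{2},\qquad \varepsilon\in\mathcal{C}_n.$$ For $i\in\{0,1,\ldots,n\}$, $$\mathcal{E}_i f(\varepsilon)=\frac{1}{2^{n-i}}\sum_{\delta_{i+1},\ldots,\delta_n\in\{-1,1\}} f(\varepsilon_1,\ldots,\varepsilon_i,\delta_{i+1},\ldots,\delta_n),\qquad \varepsilon\in\mathcal{C}_n,$$ so $\mathcal{E}_n f=f$ and $\mathcal{E}_0 f=\frac1{2^n}\sum_{\delta\in\mathcal{C}_n}f(\delta)$. UMD$^-$: $X$ is a UMD$^-$ space if for every $p\in(1,\infty)$ there is $\beta_p^-\in(0,\infty)$ such that for every $n\in\mathbb{N}$,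 every probability space $(\Omega,\mathcal{F},\mu)$, every filtration $\{\mathcal{F}_i\}_{i=0}^n$ of sub-$\sigma$-algebras of $\mathcal{F}$ and every martingale $\{M_i:\Omega\to X\}_{i=0}^n$ adapted to $\{\mathcal{F}_i\}_{i=0}^n$ (with $M_i\in L_p(\Omega,\mu;X)$), $$\|M_n-M_0\|_{L_p(\Omega,\mu;X)}\leq \beta_p^-\Big(\frac1{2^n}\sum_{\delta\in\mathcal{C}_n}\Big\|\sum_{i=1}^n\delta_i(M_i-M_{i-1})\Big\|_{L_p(\Omega,\mu;X)}^p\Big)^{1/p}.$$ The least such constant is denoted $\beta_p^-(X)$. The parameter $\mathfrak{s}_p(X)\in(0,\infty]$ is the least $\mathfrak{s}\in(0,\infty]$ such that for every probability space $(\Omega,\mathcal{F},\mu)$, every $n\in\mathbb{N}$, every filtration $\{\mathcal{F}_i\}_{i=1}^n$ of sub-$\sigma$-algebras of $\mathcal{F}$ with corresponding vector valued conditional expectations $E_i=\mathbb{E}[\,\cdot\,|\mathcal{F}_i]$, every sequence of functions $f_1,\ldots,f_n:\Omega\to X$ (in $L_p(\Omega,\mu;X)$) satisfies $$\Big(\frac1{2^n}\sum_{\delta\in\mathcal{C}_n}\Big\|\sum_{i=1}^n\delta_i E_i f_i\Big\|_{L_p(\Omega,\mu;X)}^p\Big)^{1/p}\leq\mathfrak{s}\Big(\frac1{2^n}\sum_{\delta\in\mathcal{C}_n}\Big\|\sum_{i=1}^n\delta_i f_i\Big\|_{L_p(\Omega,\mu;X)}^p\Big)^{1/p}.$$ Pisier's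 constant $\mathfrak{P}_p^n(X)$ is the least constant such that every $f:\mathcal{C}_n\to X$ satisfies $$\Big\|f-\frac1{2^n}\sum_{\delta\in\mathcal{C}_n}f(\delta)\Big\|_{L_p(\mathcal{C}_n;X)}\leq\mathfrak{P}_p^n(X)\Big(\frac1{2^n}\sum_{\delta\in\mathcal{C}_n}\Big\|\sum_{i=1}^n\delta_i\partial_i f\Big\|_{L_p(\mathcal{C}_n;X)}^p\Big)^{1/p}.$$ *)

(* Defs.v *)
From HB Require Import structures.
From mathcomp Require Import all_boot all_order all_algebra.
From mathcomp Require Import all_classical all_reals all_analysis.

Set Implicit Arguments.
Unset Strict Implicit.
Unset Printing Implicit Defensive.

Import Order.TTheory GRing.Theory Num.Theory.
Import numFieldNormedType.Exports.

Local Open Scope classical_set_scope.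
Local Open Scope ring_scope.

(* A point of {-1,1}^n is encoded by the booleans e i, the i-th coordinate
   being (-1) ^+ e i; coordinates are numbered from 0 to n - 1. *)
Definition cube (n : nat) := {ffun 'I_n -> bool}.

Definition cube_coord (R : realType) (n : nat) (e : cube n) (i : 'I_n) : R :=
  (-1) ^+ (e i).

Definition flip (n : nat) (i : 'I_n) (e : cube n) : cube n :=
  [ffun j => if j == i then ~~ e j else e j].

Section Bochner.
Context {R : realType} {X : completeNormedModType R}.
Context {d : measure_display} {T : measurableType d}.
Implicit Types (G : set (set T)) (P : probability T R) (f g s : T -> X).

Definition simple_on G s : Prop :=
  finite_set (range s) /\ forall x, G (s @^-1` [set x]).

(* Everywhere, not almost everywhere, limits: every L_p class has such a
   representative. *)
Definition strongly_measurable G f :=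
  exists s : nat -> T -> X, (forall k, simple_on G (s k)) /\
    (forall t, s k t @[k --> \oo] --> f t).

Definition simple_integral P (A : set T) s : X :=
  \sum_(x \in range s) (fine (P (A `&` s @^-1` [set x])) *: x).

Definition is_bochner_integral P (A : set T) f (v : X) :=
  strongly_measurable measurable f /\
  exists s : nat -> T -> X,
    [/\ forall k, simple_on measurable (s k),
        (fun k => \int[P]_(t in A) (`|f t - s k t|)%:E)%E @ \oo --> (0 : \bar R)
      & simple_integral P A (s k) @[k --> \oo] --> v].

Definition Lp_norm P (p : R) f : \bar R :=
  Lnorm P p%:E (fun t => (`|f t|)%:E).

Definition in_Lp P (p : R) f :=
  strongly_measurable measurable f /\ (Lp_norm P p f < +oo)%E.

Definition sub_sigma_algebra G := sigma_algebra setT G /\ G `<=` measurable.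

(* g is a version of E[f | G]; taking A = setT shows that f and g are Bochner
   integrable. *)
Definition is_cond_exp P G f g :=
  strongly_measurable G g /\
  forall A, G A -> exists2 v,
    is_bochner_integral P A f v & is_bochner_integral P A g v.

Definition filtration (m : nat) (F : 'I_m -> set (set T)) :=
  (forall i, sub_sigma_algebra (F i)) /\
  (forall i j : 'I_m, (i <= j)%N -> F i `<=` F j).

Definition martingale P (m : nat) (F : 'I_m -> set (set T))
    (M : 'I_m -> T -> X) :=
  (forall i, strongly_measurable (F i) (M i)) /\
  (forall i j : 'I_m, (i <= j)%N -> is_cond_exp P (F i) (M j) (M i)).

Definition rademacher_Lp P (p : R) (n : nat) (g : 'I_n -> T -> X) : \bar R :=
  (((2 ^- n)%:E * \sum_(delta : cube n)
     Lp_norm P p (fun t => (\sum_(i < n) cube_coord R delta i *: g i t)%R) `^ p)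
     `^ p^-1)%E.

End Bochner.

(* b is an admissible constant in the one-sided UMD inequality. For i : 'I_n,
   the indices lift ord0 i and widen_ord _ i of 'I_n.+1 are i + 1 and i. *)
Definition umd_minus_bound (R : realType) (X : completeNormedModType R)
    (p b : R) :=
  0 < b /\
  forall (n : nat) (d : measure_display) (T : measurableType d)
    (P : probability T R) (F : 'I_n.+1 -> set (set T))
    (M : 'I_n.+1 -> T -> X),
    filtration F -> martingale P F M -> (forall i, in_Lp P p (M i)) ->
    (Lp_norm P p (fun t => (M ord_max t - M ord0 t)%R) <=
     b%:E * rademacher_Lp P p (fun (i : 'I_n) t =>
       (M (lift ord0 i) t - M (widen_ord (leqnSn n) i) t)%R))%E.

Definition UMD_minus (R : realType) (X : completeNormedModType R) :=
  forall p : R, 1 < p -> exists b, umd_minus_bound X p b.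

Definition beta_minus (R : realType) (X : completeNormedModType R) (p : R) :
    \bar R :=
  ereal_inf [set b%:E | b in umd_minus_bound X p].

(* s is an admissible constant in the vector-valued Stein inequality;
   g i is an arbitrary version of E[f i | F i]. *)
Definition stein_bound (R : realType) (X : completeNormedModType R)
    (p s : R) :=
  0 < s /\
  forall (n : nat) (d : measure_display) (T : measurableType d)
    (P : probability T R) (F : 'I_n -> set (set T)) (f g : 'I_n -> T -> X),
    filtration F -> (forall i, in_Lp P p (f i)) ->
    (forall i, is_cond_exp P (F i) (f i) (g i)) ->
    (rademacher_Lp P p g <= s%:E * rademacher_Lp P p f)%E.

(* +oo when there is no admissible constant (ereal_inf set0 = +oo) *)
Definition stein_const (R : realType) (X : completeNormedModType R) (p : R) :
    \bar R :=
  ereal_inf [set s%:E | s in stein_bound X p].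

Section Cube.
Context {R : realType} {X : completeNormedModType R}.
Implicit Types (n : nat) (p : R).

Definition cube_norm p n (f : cube n -> X) : R :=
  (2 ^- n * \sum_(e : cube n) `|f e| `^ p) `^ p^-1.

Definition cube_rademacher p n (g : 'I_n -> cube n -> X) : R :=
  (2 ^- n * \sum_(delta : cube n)
     cube_norm p (fun e => \sum_(i < n) cube_coord R delta i *: g i e) `^ p) `^ p^-1.

Definition cube_mean n (f : cube n -> X) : X :=
  2 ^- n *: \sum_(delta : cube n) f delta.

Definition partial n (i : 'I_n) (f : cube n -> X) : cube n -> X :=
  fun e => 2^-1 *: (f e - f (flip i e)).

(* Averaging over all coordinates but the first i: the sum runs over the
   2 ^ (n - i) points of the cube that agree with e there. *)
Definition avg n (i : nat) (f : cube n -> X) : cube n -> X :=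
  fun e => 2 ^- (n - i) *:
    \sum_(delta : cube n | [forall j : 'I_n, (j < i)%N ==> (delta j == e j)])
      f delta.

Definition pisier_bound p n (c : R) :=
  0 <= c /\ forall f : cube n -> X,
    cube_norm p (fun e => f e - cube_mean f) <=
    c * cube_rademacher p (fun i => partial i f).

End Cube.

Definition pisier_const (R : realType) (X : completeNormedModType R) (p : R)
    (n : nat) : \bar R :=
  ereal_inf [set c%:E | c in @pisier_bound R X p n].

(* Main.v *)
Require Import Defs.
From HB Require Import structures.
From mathcomp Require Import all_boot all_order all_algebra.
From mathcomp Require Import all_classical all_reals all_analysis.
Import Order.TTheory GRing.Theory Num.Theory.
Import numFieldNormedType.Exports.
Set Implicit Arguments.
Unset Strict Implicit.
Unset Printing Implicit Defensive.

Local Open Scope classical_set_scope.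
Local Open Scope ring_scope.

(** The summand [avg i.+1 (f i) - avg i (f i)] is the average [avg i.+1] of
    [partial i (f i)]: averaging over the coordinate [i] removes from [f i]
    exactly its partial derivative ([avg_increment]).  Under the uniform
    probability on the cube, [avg k] is the conditional expectation given the
    first [k] coordinates ([avg_cond_exp]), and [partial i (f i)] is odd under
    the flip of the coordinate [i], hence has zero mean on every event decided
    by the coordinates before [i] ([sum_partial_event]).  So the partial sums
    of the summands form a martingale ([increment_sum_martingale]) whose
    differences are the averages [avg i.+1 (partial i (f i))].

    The one-sided UMD inequality bounds the norm of the whole sum by the
    Rademacher norm of these differences; Stein's inequality, for the
    filtration shifted by one, then removes the conditional expectations and
    leaves the Rademacher norm of the partial derivatives ([umd_stein_cube]).
    Taking the infimum over the two admissible constants gives the first claim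
    ([le_ereal_inf_scaled]).  With all [f i] equal to one function [f] the left
    side telescopes to [f - cube_mean f], and the first claim says that the
    product of the two infima is an admissible constant in Pisier's
    inequality. *)

(** * The cube as a probability space *)

HB.instance Definition _ n := Finite.on (cube n).
HB.instance Definition _ n := isPointed.Build (cube n) [ffun=> false].
HB.instance Definition _ n := @isMeasurable.Build default_measure_display
  (cube n) discrete_measurable discrete_measurable0
  discrete_measurableC discrete_measurableU.

Lemma cube_measurable n (A : set (cube n)) : measurable A.
Proof. by []. Qed.

Section UniformMeasure.
Context {R : realType} (n : nat).

Let weight_ge0 : 0 <= (2 ^- n : R).
Proof. by rewrite invr_ge0 exprn_ge0. Qed.

(** Scaled sum of Dirac masses, so that the measure axioms and the integral
    formula come from those of [mscale], [msum] and [dirac].  The default value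
    of [nth] is never reached, the sum stopping at the cardinal. *)
Definition cube_uniform : set (cube n) -> \bar R :=
  mscale (NngNum weight_ge0)
    (msum (fun k => \d_(nth point (enum {: cube n}) k)) #|{: cube n}|).

HB.instance Definition _ := Measure.on cube_uniform.

Let sum_enum (V : nmodType) (F : cube n -> V) :
  \sum_(k < #|{: cube n}|) F (nth point (enum {: cube n}) k) = \sum_e F e.
Proof.
by rewrite -[RHS]big_enum /= (big_nth point) big_mkord cardE.
Qed.

Lemma cube_uniformE (A : set (cube n)) :
  cube_uniform A = (2 ^- n * \sum_(e : cube n) (e \in A)%:R)%:E.
Proof.
rewrite /cube_uniform /mscale /msum /= EFinM; congr (_ * _)%E.
rewrite -sumEFin -(sum_enum (fun e : cube n => ((e \in A)%:R)%:E)).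
by apply: eq_bigr => k _; rewrite /= diracE.
Qed.

Lemma cube_uniform_setT : cube_uniform setT = 1%E.
Proof.
rewrite cube_uniformE (eq_bigr (fun=> 1)) => [|e _]; last by rewrite in_setT.
by rewrite sumr_const card_ffun card_bool card_ord natrX mulVf.
Qed.

HB.instance Definition _ :=
  Measure_isProbability.Build _ _ _ cube_uniform cube_uniform_setT.

Lemma ge0_integral_uniform (f : cube n -> R) : (forall e, 0 <= f e) ->
  (\int[cube_uniform]_e (f e)%:E)%E = (2 ^- n * \sum_e f e)%:E.
Proof.
move=> f0; have f0E e : setT e -> (0 <= (f e)%:E)%E by rewrite lee_fin f0.
rewrite ge0_integral_mscale // ge0_integral_measure_sum //.
rewrite EFinM; congr (_ * _)%E.
rewrite -sumEFin -(sum_enum (fun e : cube n => (f e)%:E)).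
apply: eq_bigr => k _; rewrite integral_dirac //.
by rewrite diracT mul1e.
Qed.

End UniformMeasure.

Arguments cube_uniform {R} n A.

(** * Norms, integrals and conditional expectations on the cube *)

Section LpCube.
Context {R : realType} {X : completeNormedModType R} (n : nat) (p : R).

Lemma Lp_norm_uniform (f : cube n -> X) :
  Lp_norm (cube_uniform n) p f = (cube_norm p f)%:E.
Proof.
rewrite /Lp_norm unlock /cube_norm /=.
under eq_integral do rewrite normr_id.
by rewrite ge0_integral_uniform ?poweR_EFin // => e; exact: powR_ge0.
Qed.

Lemma rademacher_uniform (g : 'I_n -> cube n -> X) :
  rademacher_Lp (cube_uniform n) p g = (cube_rademacher p g)%:E.
Proof.
rewrite /rademacher_Lp /cube_rademacher -poweR_EFin EFinM -sumEFin.
by under eq_bigr do rewrite Lp_norm_uniform poweR_EFin.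
Qed.

End LpCube.

Section Bochner.
Context {R : realType} {X : completeNormedModType R} (n : nat).
Implicit Types (f g : cube n -> X) (A : set (cube n)).

Lemma cube_finite_range f : finite_set (range f).
Proof. by apply: finite_image; exact: finite_finset. Qed.

Lemma cube_simple_on (G : set (set (cube n))) f :
  (forall x, G (f @^-1` [set x])) -> simple_on G f.
Proof. by move=> Gf; split => //; exact: cube_finite_range. Qed.

Lemma cube_strongly_measurable (G : set (set (cube n))) f :
  (forall x, G (f @^-1` [set x])) -> strongly_measurable G f.
Proof.
move=> Gf; exists (fun=> f); split=> [_|t]; first exact: cube_simple_on.
exact: cvg_cst.
Qed.

Lemma simple_integral_uniform A f :
  simple_integral (cube_uniform n) A f = 2 ^- n *: \sum_(e | e \in A) f e.
Proof.
rewrite /simple_integral fsbig_finite /=; last exact: cube_finite_range.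
have memE x e : (e \in A `&` f @^-1` [set x]) = (e \in A) && (f e == x).
  by rewrite in_setI; congr (_ && _); apply/idP/eqP; rewrite inE.
under eq_bigr => x _.
  rewrite cube_uniformE /= -scalerA scaler_suml.
  under eq_bigr do rewrite memE.
  over.
rewrite -scaler_sumr exchange_big /= [in RHS]big_mkcond /=; congr (_ *: _).
apply: eq_bigr => e _; case: (e \in A) => /=; last first.
  by rewrite big1 // => x _; rewrite scale0r.
rewrite (bigD1_seq (f e)) /=; last 2 first.
- by rewrite in_fset_set ?inE; [exists e|exact: cube_finite_range].
- exact: finmap.fset_uniq.
rewrite eqxx scale1r big1 ?addr0 // => x; rewrite eq_sym => /negPf ->.
by rewrite scale0r.
Qed.

(** On a finite space every function is simple, so the constant sequence is an
    approximating sequence. *)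
Lemma is_bochner_integral_uniform A f :
  is_bochner_integral (cube_uniform n) A f (2 ^- n *: \sum_(e | e \in A) f e).
Proof.
split; first by apply: cube_strongly_measurable => x; exact: cube_measurable.
exists (fun=> f); split => [k||].
- by apply: cube_simple_on => x; exact: cube_measurable.
- under eq_fun do (under eq_integral do rewrite subrr normr0).
  by rewrite integral0; exact: cvg_cst.
- by rewrite simple_integral_uniform; exact: cvg_cst.
Qed.

Lemma cube_in_Lp (p : R) f : in_Lp (cube_uniform n) p f.
Proof.
split; last by rewrite Lp_norm_uniform ltry.
by apply: cube_strongly_measurable => x; exact: cube_measurable.
Qed.

End Bochner.

(** * Events decided by the first coordinates *)

Section Prefix.
Context (n : nat).
Implicit Types (e d : cube n) (A : set (cube n)).

(** The condition selecting the summands in [avg]. *)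
Definition same_prefix k e d :=
  [forall j : 'I_n, (j < k)%N ==> (d j == e j)].

Definition prefix_events k : set (set (cube n)) :=
  [set A | forall e d, same_prefix k e d -> A e -> A d].

Lemma same_prefixP k e d :
  reflect (forall j : 'I_n, (j < k)%N -> d j = e j) (same_prefix k e d).
Proof.
apply: (iffP forallP) => [H j jk|H j]; first by have /implyP/(_ jk)/eqP := H j.
by apply/implyP => jk; apply/eqP/H.
Qed.

Lemma same_prefix_sym k e d : same_prefix k e d = same_prefix k d e.
Proof. by apply/same_prefixP/same_prefixP => H j jk; rewrite H. Qed.

Lemma same_prefix_le k l e d :
  (k <= l)%N -> same_prefix l e d -> same_prefix k e d.
Proof.
move=> kl /same_prefixP H; apply/same_prefixP => j jk.
by rewrite H ?(leq_trans jk).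
Qed.

Lemma same_prefix_trans k e d :
  same_prefix k e d -> same_prefix k e =1 same_prefix k d.
Proof.
move=> /same_prefixP H c; apply/same_prefixP/same_prefixP => H' j jk.
  by rewrite H' // H.
by rewrite H' // H.
Qed.

Lemma prefix_events_le k l :
  (k <= l)%N -> prefix_events k `<=` prefix_events l.
Proof. by move=> kl A HA e d /(same_prefix_le kl); exact: HA. Qed.

Lemma prefix_events_sub_sigma k : Defs.sub_sigma_algebra (prefix_events k).
Proof.
split; last by move=> A _; exact: cube_measurable.
split=> [//|A HA|A HA] e d ed.
- move=> [_ nA]; split=> // Ad.
  by apply: nA; apply: HA Ad; rewrite same_prefix_sym.
- by move=> [i _ Ai]; exists i => //; apply: HA Ai.
Qed.

Lemma prefix_filtration m (t : 'I_m -> nat) :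
  (forall i j : 'I_m, (i <= j)%N -> (t i <= t j)%N) ->
  filtration (fun i => prefix_events (t i)).
Proof.
move=> t_mono; split=> [i|i j ij]; first exact: prefix_events_sub_sigma.
by apply: prefix_events_le; exact: t_mono.
Qed.

Lemma prefix_preimage (X : Type) k (g : cube n -> X) :
  (forall e d, same_prefix k e d -> g e = g d) ->
  forall B, prefix_events k (g @^-1` B).
Proof. by move=> gk B e d /gk /= ->. Qed.

Lemma flipE (i : 'I_n) e j : flip i e j = if j == i then ~~ e j else e j.
Proof. by rewrite ffunE. Qed.

Lemma flipK (i : 'I_n) : involutive (@flip n i).
Proof.
by move=> e; apply/ffunP => j; rewrite !flipE; case: eqP; rewrite ?negbK.
Qed.

Lemma same_prefix_flip (i : 'I_n) e : same_prefix i e (flip i e).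
Proof.
by apply/same_prefixP => j ji; rewrite flipE ifN // -val_eqE /= ltn_eqF.
Qed.

Lemma prefix_events_flip (i : 'I_n) A e :
  prefix_events i A -> (flip i e \in A) = (e \in A).
Proof.
move=> HA; apply/idP/idP; rewrite !inE; last exact/HA/same_prefix_flip.
by apply: HA; rewrite same_prefix_sym same_prefix_flip.
Qed.

Lemma same_prefixS (i : 'I_n) e d :
  same_prefix i.+1 e d = same_prefix i e d && (d i == e i).
Proof.
apply/same_prefixP/andP => [H|[/same_prefixP H /eqP di] j].
  split; last by rewrite H.
  by apply/same_prefixP => j ji; rewrite H // ltnW.
by rewrite ltnS leq_eqVlt => /predU1P[/val_inj ->|/H].
Qed.

(** The flip of coordinate [i] carries the half of a prefix class of length [i]
    that disagrees with [e] at [i] onto the half that agrees with it. *)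
Lemma same_prefix_flipS (i : 'I_n) e d :
  same_prefix i e (flip i d) && (flip i d i != e i) = same_prefix i.+1 e d.
Proof.
rewrite same_prefixS flipE eqxx; congr (_ && _).
  rewrite same_prefix_sym -(same_prefix_trans (same_prefix_flip i d)).
  by rewrite same_prefix_sym.
by case: (d i) (e i) => [] [].
Qed.

End Prefix.

(** * Averages as conditional expectations *)

Section Averages.
Context {R : realType} {X : completeNormedModType R} (n : nat).
Implicit Types (f g : cube n -> X) (A : set (cube n)) (e d : cube n).

Lemma avg_same_prefix k f e d : same_prefix k e d -> avg k f e = avg k f d.
Proof.
move=> ed; congr (_ *: _); apply: eq_bigl => c; exact: same_prefix_trans.
Qed.

Lemma avg_full f e : avg n f e = f e.
Proof.
rewrite /avg subnn expr0 invr1 scale1r (big_pred1 e) // => d.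
apply/same_prefixP/eqP => [H|-> //].
by apply/ffunP => j; apply: H.
Qed.

Lemma avg0 f e : avg 0 f e = cube_mean f.
Proof.
rewrite /avg /cube_mean subn0; congr (_ *: _); apply: eq_bigl => d.
by apply/forallP.
Qed.

(** A prefix class of length [i] splits into two halves exchanged by the flip
    of the coordinate [i]; hence [avg i f] averages [(f + f \o flip i) / 2],
    which is [f - partial i f], over the half that agrees with [e]. *)
Lemma avg_increment (i : 'I_n) f e :
  avg i.+1 f e - avg i f e = avg i.+1 (partial i f) e.
Proof.
have split_sum : \sum_(d | same_prefix i e d) f d =
    \sum_(d | same_prefix i.+1 e d) (f d + f (flip i d)).
  rewrite (bigID (fun d : cube n => d i == e i)) big_split /=; congr (_ + _).
    by apply: eq_bigl => d; rewrite same_prefixS.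
  rewrite (reindex_inj (inv_inj (flipK i))) /=.
  by apply: eq_bigl => d; rewrite same_prefix_flipS.
rewrite /avg -/(same_prefix _ _) split_sum -(subnSK (ltn_ord i)) exprS invfM.
rewrite [2^-1 * _]mulrC -!scalerA -scalerBr scaler_sumr -sumrB; congr (_ *: _).
apply: eq_bigr => d _; rewrite /partial scalerBr scalerDr.
rewrite opprD addrA; congr (_ - _).
by rewrite -[X in X - _]scale1r -scalerBl {1}(splitr 1) mul1r addrK.
Qed.

(** The event is invariant under the flip of [i], and [partial i f] changes
    sign. *)
Lemma sum_partial_event (i : 'I_n) f A : prefix_events i A ->
  \sum_(e | e \in A) partial i f e = 0.
Proof.
move=> HA; rewrite -scaler_sumr sumrB.
rewrite [X in _ - X](reindex_inj (inv_inj (flipK i))) /=.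
rewrite [X in _ - X](eq_big (fun e => e \in A) f) ?subrr ?scaler0 // => e.
  exact: prefix_events_flip.
by rewrite flipK.
Qed.

(** Downward induction from [avg n f = f]: passing from [k.+1] to [k] replaces
    [f] by [f - partial k f], which has the same sum over the event because
    [partial k f] sums to zero there. *)
Lemma sum_avg_event k f A : (k <= n)%N -> prefix_events k A ->
  \sum_(e | e \in A) avg k f e = \sum_(e | e \in A) f e.
Proof.
move=> kn; rewrite -(subKn kn).
elim: (n - k)%N f (leq_subr k n) => [|m IH] f mn HA.
  by rewrite subn0; apply: eq_bigr => e _; rewrite avg_full.
have i_lt : (n - m.+1 < n)%N by rewrite ltn_subrL (leq_ltn_trans _ mn).
pose i := Ordinal i_lt.
have iS : i.+1 = (n - m)%N by rewrite /= subnSK.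
have HA' : prefix_events (n - m)%N A.
  by rewrite -iS; apply: prefix_events_le HA; exact: leqnSn.
transitivity (\sum_(e | e \in A) (avg i.+1 f e - avg i.+1 (partial i f) e)).
  by apply: eq_bigr => e _; rewrite -avg_increment opprB addrC subrK.
by rewrite sumrB iS !IH ?(ltnW mn) // (sum_partial_event (i := i)) ?subr0.
Qed.

(** The integral over an event is [2 ^- n] times the sum over it, so equality of
    sums is the averaging property of the conditional expectation. *)
Lemma prefix_cond_exp k f g :
  (forall e d, same_prefix k e d -> g e = g d) ->
  (forall A, prefix_events k A ->
    \sum_(e | e \in A) f e = \sum_(e | e \in A) g e) ->
  is_cond_exp (cube_uniform n) (prefix_events k) f g.
Proof.
move=> gk fg; split.
  by apply: cube_strongly_measurable => x; exact: prefix_preimage.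
move=> A /fg fgA; exists (2 ^- n *: \sum_(e | e \in A) f e).
  exact: is_bochner_integral_uniform.
by rewrite fgA; exact: is_bochner_integral_uniform.
Qed.

Lemma avg_cond_exp k f : (k <= n)%N ->
  is_cond_exp (cube_uniform n) (prefix_events k) f (avg k f).
Proof.
move=> kn; apply: prefix_cond_exp => [e d|A HA]; first exact: avg_same_prefix.
by rewrite sum_avg_event.
Qed.

End Averages.

(** * The martingale and the inequality *)

Section Inequality.
Context {R : realType} {X : completeNormedModType R} (p : R).

Definition increment_sum n (f : 'I_n -> cube n -> X) (k : 'I_n.+1)
    (e : cube n) :=
  \sum_(i < n | (i < k)%N) avg i.+1 (partial i (f i)) e.

(** An increment of index [i >= k] sums to zero over an event decided by the
    first [k] coordinates: the average [avg i.+1] does not change the sum, and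
    [partial i (f i)] sums to zero. *)
Lemma increment_sum_martingale n (f : 'I_n -> cube n -> X) :
  martingale (cube_uniform n) (fun k : 'I_n.+1 => prefix_events k)
    (increment_sum f).
Proof.
have adapted (k : 'I_n.+1) e d :
    same_prefix k e d -> increment_sum f k e = increment_sum f k d.
  move=> ed; apply: eq_bigr => i ik; apply: avg_same_prefix.
  exact: same_prefix_le ed.
split=> [k|k l kl].
  apply: cube_strongly_measurable => x.
  by apply: prefix_preimage; exact: adapted.
apply: prefix_cond_exp => [|A HA]; first exact: adapted.
rewrite /increment_sum [LHS]exchange_big [RHS]exchange_big /=.
rewrite (bigID (fun i : 'I_n => (i < k)%N)) /= [X in _ + X]big1 ?addr0.
  apply: eq_bigl => i; case: (ltnP i k) => ik; rewrite ?andbF //.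
  by rewrite (leq_trans ik kl).
move=> i /andP[_]; rewrite -leqNgt => ki.
have HAi : prefix_events i A by apply: prefix_events_le HA.
rewrite sum_avg_event ?sum_partial_event //.
exact: prefix_events_le HAi.
Qed.

(** The UMD inequality uses the sigma-algebras of prefixes of length [0] to
    [n]; Stein's inequality uses those of length [1] to [n], because the
    difference of index [i], [avg i.+1 (partial i (f i))], is a conditional
    expectation given the first [i.+1] coordinates. *)
Lemma umd_stein_cube n (b s : R) (f : 'I_n -> cube n -> X) :
  umd_minus_bound X p b -> stein_bound X p s ->
  cube_norm p (fun e => \sum_(i < n) (avg i.+1 (f i) e - avg i (f i) e)) <=
    s * b * cube_rademacher p (fun i => partial i (f i)).
Proof.
move=> [b0 umd] [s0 stein].
pose D (i : 'I_n) := avg i.+1 (partial i (f i)).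
have := umd n _ _ (cube_uniform n) (fun k : 'I_n.+1 => prefix_events k)
  (increment_sum f) (prefix_filtration n (fun i j ij => ij))
  (increment_sum_martingale f) (fun k => cube_in_Lp _ _).
have -> : (fun e => increment_sum f ord_max e - increment_sum f ord0 e) =
    (fun e => \sum_(i < n) (avg i.+1 (f i) e - avg i (f i) e)).
  apply/funext => e; rewrite /increment_sum [X in _ - X]big1 ?subr0 //.
  by apply: eq_big => i; rewrite ?ltn_ord // avg_increment.
have -> : (fun (i : 'I_n) e => increment_sum f (lift ord0 i) e -
    increment_sum f (widen_ord (leqnSn n) i) e) = D.
  apply/funext => i; apply/funext => e; rewrite /increment_sum /=.
  rewrite (bigD1 i) //= (eq_bigl (fun j : 'I_n => (j < i)%N)) ?addrK //.
  by move=> j; rewrite [RHS]ltn_neqAle andbC.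
rewrite Lp_norm_uniform rademacher_uniform -EFinM lee_fin => /le_trans; apply.
have := stein n _ _ (cube_uniform n) (fun i : 'I_n => prefix_events i.+1)
  (fun i => partial i (f i)) D
  (@prefix_filtration n n (fun i => i.+1) (fun i j ij => ij))
  (fun i => cube_in_Lp _ _) (fun i => avg_cond_exp _ (ltn_ord i)).
rewrite !rademacher_uniform -EFinM lee_fin => Dle.
by rewrite mulrAC [leLHS]mulrC ler_pM2r.
Qed.

End Inequality.

(** * Passing to the best constants *)

(** Nonemptiness matters when [c = 0]: the infimum of the empty set is [+oo],
    and [+oo * 0 = 0] would not bound [x]. *)
Lemma le_ereal_inf_scaled (R : realType) (B : set R) (x : \bar R) (c : R) :
  0 <= c -> B !=set0 -> (forall b, B b -> (x <= b%:E * c%:E)%E) ->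
  (x <= ereal_inf [set b%:E | b in B] * c%:E)%E.
Proof.
rewrite le_eqVlt => /predU1P[<- [b Bb] /(_ _ Bb)|c0 _ H].
  by rewrite !mule0.
rewrite -lee_pdivrMr //; apply/ereal_infP => _ [b Bb <-].
by rewrite lee_pdivrMr // H.
Qed.

Lemma ereal_inf_EFin_ge0 (R : realType) (B : set R) :
  (forall b, B b -> 0 <= b) -> B !=set0 ->
  exists2 r : R, 0 <= r & ereal_inf [set b%:E | b in B] = r%:E.
Proof.
move=> B0 [b Bb].
have ge0 : (0 <= ereal_inf [set b%:E | b in B])%E.
  by apply/ereal_infP => _ [c Bc <-]; rewrite lee_fin B0.
have fin : ereal_inf [set b%:E | b in B] \is a fin_num.
  rewrite ge0_fin_numE //; apply: le_lt_trans (ltry b).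
  by apply: ereal_inf_lbound; exists b.
by exists (fine (ereal_inf [set b%:E | b in B])); rewrite ?fine_ge0 ?fineK.
Qed.

Theorem theorem1 (R : realType) (X : completeNormedModType R) (p : R)
    (hp : 1 < p) (hs : (stein_const X p < +oo)%E) (hX : UMD_minus X) :
  (forall (n : nat) (f : 'I_n -> cube n -> X),
     ((cube_norm p (fun e =>
         (\sum_(i < n) (avg i.+1 (f i) e - avg i (f i) e))%R))%:E <=
      stein_const X p * beta_minus X p *
        (cube_rademacher p (fun i => partial i (f i)))%:E)%E) /\
  (ereal_sup (range (fun n : nat => pisier_const X p n)) <=
     stein_const X p * beta_minus X p)%E.
Proof.
have umd_ne : umd_minus_bound X p !=set0 by exact: hX.
have stein_ne : stein_bound X p !=set0.
  apply: contrapT => /set0P/negP/negPn/eqP stein0.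
  by move: hs; rewrite /stein_const stein0 image_set0 ereal_inf0.
have [s s0 sE] := ereal_inf_EFin_ge0 (fun s (H : stein_bound X p s) => ltW H.1)
  stein_ne.
have [b b0 bE] := ereal_inf_EFin_ge0 (fun b (H : umd_minus_bound X p b) =>
  ltW H.1) umd_ne.
have main n (f : 'I_n -> cube n -> X) :
   ((cube_norm p (fun e =>
       \sum_(i < n) (avg i.+1 (f i) e - avg i (f i) e)))%:E <=
      stein_const X p * beta_minus X p *
        (cube_rademacher p (fun i => partial i (f i)))%:E)%E.
  set c := cube_rademacher _ _.
  have c0 : 0 <= c by exact: powR_ge0.
  rewrite -muleA [beta_minus X p]bE -EFinM.
  (* The infimum over the Stein constants, the UMD infimum being a real [b]. *)
  apply: le_ereal_inf_scaled => [||s' Hs]; rewrite ?mulr_ge0 //.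
  rewrite EFinM muleCA -bE muleA [(_ * s'%:E)%E]muleC -muleA muleCA -EFinM.
  (* The infimum over the UMD constants, for a fixed Stein constant [s']. *)
  apply: le_ereal_inf_scaled => [||b' Hb]; rewrite ?mulr_ge0 // ?(ltW Hs.1) //.
  by rewrite -EFinM lee_fin mulrA [b' * s']mulrC umd_stein_cube.
split=> //; apply: ge_ereal_sup => _ [n _ <-].
rewrite [stein_const X p]sE [beta_minus X p]bE -EFinM.
apply: ereal_inf_lbound; exists (s * b) => //; split; first exact: mulr_ge0.
move=> f; have := main n (fun=> f).
rewrite [stein_const X p]sE [beta_minus X p]bE -!EFinM lee_fin.
have -> // : (fun e => \sum_(i < n) (avg i.+1 f e - avg i f e)) =
  (fun e => f e - cube_mean f).
apply/funext => e.
rewrite -(big_mkord xpredT (fun i => avg i.+1 f e - avg i f e)).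
by rewrite telescope_sumr // avg_full avg0.
Qed.
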